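(* Let $n\in\mathbb{N}$ and let $p$ be any prime. Let $P_n$ be a Sylow $p$-subgroup of the symmetric group $\mathfrak{S}_n$ and let $N=N_{\mathfrak{S}_n}(P_n)$ be its normaliser. Let $\phi$ and $\psi$ be linear characters of $P_n$. Then the induced characters $\phi\uparrow_{P_n}^{\mathfrak{S}_n}$ and $\psi\uparrow_{P_n}^{\mathfrak{S}_n}$ are equal if, and only if, $\phi$ and $\psi$ are $N$-conjugate.
   Context: Characters are ordinary (complex) characters; a linear character is a character of degree 1. The group $N$ acts by conjugation on the set of linear characters of $P_n$, and two linear characters are $N$-conjugate if they lie in the same orbit of this action. *)

(* Defs.v *)
(* Ordinary characters are valued in algC, the field of algebraic complex
   numbers, which contains all values of complex characters of finite groups. *)
From mathcomp Require Export all_boot all_order all_fingroup all_algebra.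
From mathcomp Require Export all_solvable all_field all_character.

Global Set Implicit Arguments.
Global Unset Strict Implicit.
Global Unset Printing Implicit Defensive.

(* Main.v *)
Require Import Defs.
From mathcomp Require Import ring.

(* For a linear character phi of P, summing phi(g) times the cycle-type monomial
   of g over P gives a polynomial in variables x_0, x_1, ... (x_j marking cycles
   of length p^j) that is determined by the character induced from phi.  A Sylow
   subgroup is a direct product of iterated wreath products P_k of cyclic groups
   of order p, one factor P_k for each block of p^k points, and the polynomial is
   the product of those of the factors.  For P_(k+1) = P_k wr C_p it is
   z^p + d * shift(z), where z belongs to the restriction of phi to P_k, shift
   replaces x_j by x_(j+1), and the nonzero constant d depends only on k and on
   whether phi is trivial on the top C_p.  Hence a factor P_k contributes z_e, where e
   in {0,1}^k says on which levels phi is nontrivial, and e determines the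
   N(P_k)-orbit of phi.  As z_e is affine in x_k with constant slope, and monic of
   degree p^k in x_0, the z_e are irreducible and pairwise non-associate, so the
   product determines the multiset of the e's, that is, the N-orbit of phi. *)

Import Order.TTheory GRing.Theory Num.Theory.
Local Open Scope group_scope.
Local Open Scope ring_scope.

(** * The polynomials z_e *)

Section CycleIndexAlgebra.

Variables (p : nat) (D : bool -> nat -> algC).
Hypothesis p_gt1 : (1 < p)%N.
Hypothesis D_neq0 : forall c k, D c k != 0.
Hypothesis D_inj : forall k, injective (D^~ k).

Implicit Types (x y : nat -> algC) (e : seq bool).

Definition shift x : nat -> algC := fun j => x j.+1.

(* [zpol e x] is the value at [x] of the polynomial z_e; the head of [e] describes
   the outermost wreath product. *)
Fixpoint zpol e x : algC :=
  if e is c :: e' then zpol e' x ^+ p + D c (size e') * zpol e' (shift x)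
  else x 0%N.

(** The coefficient of [x (size e)], the last variable that occurs in z_e. *)
Fixpoint slope e : algC :=
  if e is c :: e' then D c (size e') * slope e' else 1.

Lemma slope_neq0 e : slope e != 0.
Proof. by elim: e => [|c e IHe] /=; rewrite ?oner_neq0 // mulf_neq0. Qed.

(** In z_(c :: e) the [p]-th power involves only variables before the last one, which enters through
    the shifted summand; there it is affine by induction. *)
Lemma zpol_affine e x y :
    (forall j, (j < size e)%N -> x j = y j) ->
  zpol e x - zpol e y = slope e * (x (size e) - y (size e)).
Proof.
elim: e x y => [|c e IHe] x y /= eq_xy; first by rewrite mul1r.
have -> : zpol e x = zpol e y.
  apply/eqP; rewrite -subr_eq0 IHe => [|j lt_j]; last exact/eq_xy/ltnW.
  by rewrite eq_xy // subrr mulr0.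
by rewrite opprD addrACA subrr add0r -mulrBr IHe => [|j lt_j];
  [rewrite mulrA | apply: eq_xy].
Qed.

Lemma eq_zpol e x y :
  (forall j, (j <= size e)%N -> x j = y j) -> zpol e x = zpol e y.
Proof.
move=> eq_xy; apply/eqP; rewrite -subr_eq0 zpol_affine => [|j /ltnW/eq_xy //].
by rewrite eq_xy // subrr mulr0.
Qed.

Definition scons t y : nat -> algC := fun j => if j is j'.+1 then y j' else t.

(* [zpol] as a polynomial in [x 0], the values [y] of the other variables being
   fixed. *)
Fixpoint zpoly e y : {poly algC} :=
  if e is c :: e' then zpoly e' y ^+ p + (D c (size e') * zpol e' y)%:P else 'X.

Lemma zpolyE e y t : (zpoly e y).[t] = zpol e (scons t y).
Proof.
by elim: e => [|c e IHe] /=; rewrite ?hornerX // hornerD horner_exp hornerC IHe.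
Qed.

Lemma size_zpoly e y : size (zpoly e y) = (p ^ size e).+1.
Proof.
elim: e => [|c e IHe] /=; first by rewrite size_polyX.
have sz : size (zpoly e y ^+ p) = (p ^ (size e).+1).+1.
  have nz : zpoly e y != 0 by rewrite -size_poly_eq0 IHe.
  have := size_exp (zpoly e y) p; rewrite IHe /= -expnSr => <-.
  by rewrite prednK // lt0n size_poly_eq0 expf_neq0.
rewrite size_polyDl // sz (leq_ltn_trans (size_polyC_leq1 _)) // ltnS.
by rewrite expn_gt0 (ltn_trans _ p_gt1).
Qed.

Lemma monic_zpoly e y : zpoly e y \is monic.
Proof.
elim: e => [|c e IHe] /=; first exact: monicX.
have mon : zpoly e y ^+ p \is monic by exact: monic_exp.
apply/monicP; rewrite lead_coefDl; first exact/monicP.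
have nz := monic_neq0 IHe.
have := size_exp (zpoly e y) p; rewrite size_zpoly /= => sz.
have: (0 < (size (zpoly e y ^+ p)).-1)%N.
  by rewrite sz muln_gt0 expn_gt0 (ltn_trans _ p_gt1).
case: (size _) => [//|[//|m] _].
by rewrite (leq_ltn_trans (size_polyC_leq1 _)).
Qed.

(* The cofactor of [q - r] in [q ^+ p - r ^+ p] has leading coefficient [p],
   so it would have positive degree. *)
Lemma monic_expr_inj (q r : {poly algC}) :
    q \is monic -> r \is monic -> size q = size r -> (1 < size q)%N ->
  (size (q ^+ p - r ^+ p)%R <= 1)%N -> q = r.
Proof.
move=> mq mr eqs sq; apply: contraTeq => ne_qr; rewrite -ltnNge.
have nz : q - r != 0 by rewrite subr_eq0.
set d := (size q).-1.
have d_gt0 : (0 < d)%N by rewrite /d -ltnS prednK // ltnW.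
set S := \sum_(i < p) q ^+ (p.-1 - i) * r ^+ i.
have cS : S`_(d * p.-1) = p%:R.
  rewrite coef_sum (eq_bigr (fun=> 1)) ?sumr_const ?card_ord // => i _.
  have mi : q ^+ (p.-1 - i) * r ^+ i \is monic by rewrite monicMl ?monic_exp.
  have le_i : (i <= p.-1)%N by rewrite -ltnS prednK // (ltn_trans _ p_gt1).
  have sz : size (q ^+ (p.-1 - i) * r ^+ i) = (d * p.-1).+1.
    rewrite size_monicM ?monic_exp ?monic_neq0 ?monic_exp //.
    have e1 m (s : {poly algC}) : s \is monic -> size s = size q ->
      size (s ^+ m) = (d * m).+1.
      move=> ms ss; have := size_exp s m; rewrite ss -/d => <-.
      by rewrite prednK // lt0n size_poly_eq0 monic_neq0 ?monic_exp.
    by rewrite !e1 // addSn addnS /= -mulnDr subnK.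
  by have /monicP := mi; rewrite lead_coefE sz.
have sS : (d * p.-1 < size S)%N.
  rewrite ltnNge; apply/negP=> /leq_sizeP/(_ _ (leqnn _))/eqP.
  by rewrite cS pnatr_eq0 -leqn0 leqNgt (ltn_trans _ p_gt1).
have Snz : S != 0 by rewrite -size_poly_gt0 (leq_ltn_trans _ sS).
rewrite (_ : q ^+ p - r ^+ p = (q - r) * S); last exact: subrXX.
rewrite size_mul //.
have p1: (0 < p.-1)%N by rewrite -ltnS prednK // (ltn_trans _ p_gt1).
have: (0 < size (q - r)%R)%N by rewrite size_poly_gt0.
case: (size (q - r)%R) => // m _; rewrite addSn /=.
apply: leq_trans (leq_addl _ _); apply: leq_trans sS.
by rewrite ltnS muln_gt0 d_gt0.
Qed.

(** Equal polynomials have [p]-th powers that differ by a constant, so [monic_expr_inj] peels off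
    the outer level; the constant terms then give back the head, because [zpol e y] is nonzero. *)
Lemma zpoly_inj K y e e' :
    (forall e, (size e < K)%N -> zpol e y != 0) ->
    (size e <= K)%N -> size e = size e' ->
  zpoly e y = zpoly e' y -> e = e'.
Proof.
move=> y_nz; elim: e e' => [|c e IHe] [|c' e'] //= le_K [eqs].
move=> eqz.
have eq_e : e = e'.
  apply: (IHe _ (ltnW le_K) eqs); apply: monic_expr_inj; rewrite ?monic_zpoly //.
  - by rewrite !size_zpoly eqs.
  - by rewrite size_zpoly ltnS expn_gt0 (ltn_trans _ p_gt1).
  rewrite (_ : _ - _ = (D c' (size e') * zpol e' y - D c (size e) * zpol e y)%:P).
    exact: size_polyC_leq1.
  by rewrite rmorphB; apply/eqP; rewrite subr_eq addrAC eq_sym subr_eq addrC eqz addrC.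
move: eqz; rewrite -{}eq_e => /addrI/polyC_inj/(mulIf (y_nz _ le_K)).
by move/D_inj->.
Qed.

(** The second condition separates the ratios z_e / slope for words of equal length, hence their
    roots in the last variable; nonvanishing keeps lower factors from hiding these roots. *)
Definition generic K x := forall e, (size e <= K)%N ->
  zpol e x != 0 /\
  forall e', size e' = size e -> slope e' * zpol e x = slope e * zpol e' x -> e = e'.

Fixpoint words k : seq (seq bool) :=
  if k is k'.+1 then [::] :: [seq b :: e | b <- [:: true; false], e <- words k']
  else [:: [::]].

Lemma mem_words k e : (size e <= k)%N -> e \in words k.
Proof.
elim: k e => [|k IHk] [|c e] //= le_k; rewrite in_cons /= mem_cat cats0.
by case: c; rewrite (map_f (cons _)) ?orbT ?IHk.
Qed.

(* Only [x 0] has to be chosen: the polynomials [zpoly e y] are monic, and pairwise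
   distinct as soon as [zpol] does not vanish at [y]. *)
Lemma generic_exists K : exists x, generic K x.
Proof.
elim: K => [|K [y gen_y]].
  exists (fun=> 1) => -[|//] _ /=; split=> [|[]//]; exact: oner_neq0.
have y_nz e : (size e < K.+1)%N -> zpol e y != 0 by move/gen_y=> [].
pose F (ee : seq bool * seq bool) :=
  zpoly ee.1 y * (slope ee.2 *: zpoly ee.1 y - slope ee.1 *: zpoly ee.2 y).
pose W := [seq (e, e') | e <- words K.+1, e' <- words K.+1].
pose Q (ee : seq bool * seq bool) :=
  [&& (size ee.1 <= K.+1)%N, size ee.2 == size ee.1 & ee.1 != ee.2].
pose G (e : seq bool) := zpoly e y.
have: \prod_(ee <- W | Q ee) F ee * \prod_(e <- words K.+1) G e != 0.
  rewrite mulf_neq0 //; last first.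
    elim/big_rec: _ => [|e q _ q0]; rewrite ?oner_neq0 // mulf_neq0 //.
    exact/monic_neq0/monic_zpoly.
  elim/big_rec: _ => [|[e e'] q /and3P[/= le_e /eqP eqs ne_e] q0].
    by rewrite oner_neq0.
  rewrite mulf_neq0 // mulf_neq0 //=; first exact/monic_neq0/monic_zpoly.
  (* For equal slopes the polynomials themselves differ; for distinct slopes the leading
     coefficients do. *)
  have [eq_u|ne_u] := eqVneq (slope e) (slope e').
    rewrite eq_u -scalerBr scaler_eq0 negb_or slope_neq0 subr_eq0.
    by apply: contraNneq ne_e => eqz; apply/eqP/(zpoly_inj y_nz).
  apply: contraNneq ne_u => /(congr1 (fun q : {poly algC} => q`_(p ^ size e))).
  have c1 f : size f = size e -> (zpoly f y)`_(p ^ size e) = 1.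
    by move=> sf; have /monicP := monic_zpoly f y; rewrite lead_coefE size_zpoly sf.
  rewrite coef0 coefB !coefZ !c1 // !mulr1 => /eqP.
  by rewrite subr_eq0 eq_sym.
(* A non-root [t] of this single product meets all the finitely many conditions at once; it becomes
   the new [x 0]. *)
move/closed_nonrootP=> [t]; rewrite /root hornerM mulf_eq0 negb_or !horner_prod.
case/andP=> nz1 nz2; exists (scons t y) => e le_e; rewrite -!zpolyE; split.
  by apply: contraNneq nz2 => z0; rewrite (big_rem e) ?mem_words //= z0 mul0r.
move=> e' eqs eqz; apply: contraNeq nz1 => ne_e.
rewrite -big_filter (big_rem (e, e')); last first.
  rewrite mem_filter {1}/Q [X in X && _]/= le_e eqs eqxx ne_e andTb.
  by apply/allpairsP; exists (e, e'); rewrite !mem_words ?eqs.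
have F0 : (F (e, e')).[t] = 0.
  rewrite /F /fst /snd !(hornerM, hornerD, hornerN, hornerZ) eqz.
  by rewrite (zpolyE e') subrr mulr0.
by rewrite F0; apply/eqP/mul0r.
Qed.

Definition subst_at K t x : nat -> algC := fun j => if j == K then t else x j.

Lemma zpol_subst_lt K t x e : (size e < K)%N -> zpol e (subst_at K t x) = zpol e x.
Proof.
move=> lt_e; apply: eq_zpol => j le_j.
by rewrite /subst_at ltn_eqF // (leq_ltn_trans le_j).
Qed.

(** The value of the last variable at which z_e vanishes, the others being those of [x]. *)
Definition zroot x e := x (size e) - zpol e x / slope e.

Lemma zpol_subst t x e :
  zpol e (subst_at (size e) t x) = slope e * (t - zroot x e).
Proof.
apply/eqP; rewrite -(inj_eq (addIr (- zpol e x))); apply/eqP.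
rewrite zpol_affine => [|j lt_j]; last by rewrite /subst_at ltn_eqF.
rewrite /subst_at eqxx /zroot; have nz := slope_neq0 e.
by field.
Qed.
Lemma prod_zpol_subst (K : nat) E t x : all (fun e => size e == K) E ->
  \prod_(e <- E) zpol e (subst_at K t x) =
  \prod_(e <- E) slope e * (\prod_(e <- E) ('X - (zroot x e)%:P)).[t].
Proof.
move=> /allP sE; rewrite horner_prod -big_split /=; apply: eq_big_seq => e /sE/eqP <-.
by rewrite zpol_subst hornerXsubC.
Qed.

Lemma prod_zpol_lt (K : nat) R t x : all (fun e => size e < K)%N R ->
  \prod_(e <- R) zpol e (subst_at K t x) = \prod_(e <- R) zpol e x.
Proof. by move=> /allP sR; apply: eq_big_seq => e /sR/zpol_subst_lt. Qed.

Lemma poly_ext (q r : {poly algC}) : (forall t, q.[t] = r.[t]) -> q = r.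
Proof.
move=> eq_qr; apply/eqP; rewrite -subr_eq0; apply: contraT => /closed_nonrootP[t].
by rewrite /root hornerD hornerN eq_qr subrr eqxx.
Qed.

(* At a generic [x], both sides are polynomials in [t := x K] whose roots identify
   the factors of top level. *)
Lemma prod_zpol_top K E E' R R' :
    all (fun e => size e == K) E -> all (fun e => size e == K) E' ->
    all (fun e => size e < K)%N R -> all (fun e => size e < K)%N R' ->
    (forall x, \prod_(e <- E) zpol e x * \prod_(e <- R) zpol e x =
               \prod_(e <- E') zpol e x * \prod_(e <- R') zpol e x) ->
  perm_eq E E' /\ forall x, \prod_(e <- R) zpol e x = \prod_(e <- R') zpol e x.
Proof.
move=> sE sE' sR sR' eqz.
pose L E x := \prod_(e <- E) ('X - (zroot x e)%:P).
pose u E := \prod_(e <- E) slope e.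
have nz_u E0 : u E0 != 0 by rewrite prodf_seq_neq0; apply/allP=> e _; rewrite slope_neq0.
pose z R x := \prod_(e <- R) zpol e x.
have eqL x : (u E * z R x) *: L E x = (u E' * z R' x) *: L E' x.
  apply: poly_ext => t; have := eqz (subst_at K t x).
  rewrite (prod_zpol_subst _ _ sE) (prod_zpol_subst _ _ sE').
  rewrite (prod_zpol_lt _ _ sR) (prod_zpol_lt _ _ sR') !hornerZ -/(u E) -/(u E').
  by rewrite -/(L E x) -/(L E' x) -/(z R x) -/(z R' x) mulrAC => ->; rewrite mulrAC.
have monL E0 x : L E0 x \is monic by rewrite monic_prod_XsubC.
(* Both [L E x] and [L E' x] are monic, so leading coefficients isolate the scalar factors. *)
have eqc x : u E * z R x = u E' * z R' x.
  have := congr1 lead_coef (eqL x); rewrite !lead_coefZ !(monicP (monL _ _)).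
  by rewrite !mulr1.
have permE : perm_eq E E'.
  have [x gen_x] := generic_exists K.
  have zR0 : u E * z R x != 0.
    rewrite mulf_neq0 // prodf_seq_neq0; apply/allP=> e eR.
    by have [] := gen_x e (ltnW (allP sR _ eR)).
  have: L E x = L E' x by have := eqL x; rewrite -eqc => /(scalerI zR0).
  rewrite /L -!(big_map (zroot x) predT (fun a => 'X - a%:P)).
  move/prod_XsubC_eq => perm_r.
  have inj_r e e' : size e == K -> size e' == K -> zroot x e = zroot x e' -> e = e'.
    move=> /eqP se /eqP se'; rewrite /zroot se se' => /addrI/oppr_inj eqd.
    have [_] := gen_x e (eq_leq se); apply; first by rewrite se.
    have -> : zpol e x = slope e * (zpol e' x / slope e').
      by rewrite -eqd mulrC divfK ?slope_neq0.
    by rewrite mulrCA [slope e' * _]mulrC divfK ?slope_neq0.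
  have sEE' : all (fun e => size e == K) (E ++ E') by rewrite all_cat sE sE'.
  (* A left inverse of [zroot x] on the words at hand turns the permutation of roots into one of
     words. *)
  pose g v := nth [::] (E ++ E') (index v [seq zroot x e | e <- E ++ E']).
  have gK e : e \in E ++ E' -> g (zroot x e) = e.
    move=> eEE; have re := map_f (zroot x) eEE.
    have lt_i := re; rewrite -index_mem size_map in lt_i.
    apply: inj_r; last by rewrite -(nth_map _ 0) // nth_index.
      by apply: (allP sEE'); rewrite mem_nth.
    exact: (allP sEE').
  have := perm_map g perm_r; rewrite -!map_comp.
  by rewrite !map_id_in // => e eE; apply: gK; rewrite mem_cat eE ?orbT.
split=> // x; apply: (mulfI (nz_u E)).
by rewrite -/(z R x) -/(z R' x) eqc /u (perm_big _ permE).
Qed.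
End CycleIndexAlgebra.

(** * Linear characters as functions, and their cycle indices *)

Section LinearFunctions.

Variable gT : finGroupType.
Implicit Types (P : {group gT}) (chi xi : gT -> algC).

(** Characters are plain functions constrained only on [P], so that restriction and transport are
    mere composition. *)
Definition lin_on (P : {set gT}) chi :=
  chi 1%g = 1 /\ {in P &, forall g h, chi (g * h)%g = chi g * chi h}.

Definition norm_conj (P : {set gT}) chi xi :=
  exists2 s, s \in 'N(P)%g & {in P, forall g, xi g = chi (g ^ s)%g}.

Lemma lin_on_neq0 P chi g : lin_on P chi -> g \in P -> chi g != 0.
Proof.
case=> chi1 chiM Pg; apply: contraTneq (oner_neq0 algC) => chi_g0.
by rewrite -chi1 -(mulgV g) chiM ?groupV // chi_g0 mul0r eqxx.
Qed.

Lemma lin_on_prod P chi (I : Type) (r : seq I) (Q : pred I) (F : I -> gT) :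
    lin_on P chi -> (forall i, F i \in P) ->
  chi (\prod_(i <- r | Q i) F i)%g = \prod_(i <- r | Q i) chi (F i).
Proof.
move=> [chi1 chiM] PF; elim: r => [|i r IHr]; first by rewrite !big_nil.
by rewrite !big_cons; case: (Q i); rewrite // chiM ?IHr // group_prod.
Qed.

End LinearFunctions.

Section CycleIndex.

Variable p : nat.
Implicit Types (X Y : finType) (y : nat -> algC).

(* For a [p]-element [g] the cycle through [u] has length [p ^ level N g u],
   provided [N] is large enough. *)
Fixpoint level N X (g : {perm X}) u : nat :=
  if N is N'.+1 then if g u == u then 0 else (level N' (g ^+ p)%g u).+1 else 0.

(** The product runs over points, not cycles: a cycle of length p^j contributes y_j to the power
    p^j, which plays the part of x_j. *)
Definition weight N X (g : {perm X}) y : algC := \prod_u y (level N g u).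

Definition cycle_index N X (P : {set {perm X}}) (chi : {perm X} -> algC) y :=
  \sum_(g in P) chi g * weight N g y.

Lemma level_inj N X Y (h : X -> Y) (g : {perm X}) (k : {perm Y}) u :
  injective h -> (forall u, k (h u) = h (g u)) -> level N k (h u) = level N g u.
Proof.
move=> inj_h; elim: N g k => [|N IHN] g k //= kh.
rewrite kh (inj_eq inj_h) (IHN (g ^+ p)%g) // => v.
by elim: p v => [|n IHn] v; rewrite ?perm1 // !expgS !permM kh IHn.
Qed.

Lemma weight_bij N X Y (h : X -> Y) (g : {perm X}) (k : {perm Y}) y :
    bijective h -> (forall u, k (h u) = h (g u)) ->
  weight N k y = weight N g y.
Proof.
move=> bij_h kh; rewrite /weight (reindex h) /=; last exact: onW_bij.
by apply: eq_bigr => u _; rewrite (level_inj _ _ (bij_inj bij_h) kh).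
Qed.

Lemma weightJ N X (g s : {perm X}) y : weight N (g ^ s)%g y = weight N g y.
Proof.
apply: (@weight_bij _ _ _ s) => [|u]; last by rewrite permJ.
by exists (s^-1)%g => u; rewrite ?permK ?permKV.
Qed.

End CycleIndex.

(** * Powers, wreath products and direct products *)

Section Blocks.

Variables (X I : finType).
Implicit Types (f : {ffun I -> {perm X}}) (s : {perm I}).

Lemma blk_subproof f : injective (fun u : X * I => (f u.2 u.1, u.2)).
Proof.
move=> [u i] [v j] [/= eq_f eq_i]; rewrite eq_i in eq_f *.
by rewrite (perm_inj eq_f).
Qed.

Definition blk f : {perm X * I} := perm (@blk_subproof f).

Lemma blkE f u i : blk f (u, i) = (f i u, i).
Proof. by rewrite permE. Qed.

Lemma top_subproof s : injective (fun u : X * I => (u.1, s u.2)).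
Proof. by move=> [u i] [v j] [/= -> /perm_inj->]. Qed.

Definition top s : {perm X * I} := perm (@top_subproof s).

Lemma topE s u i : top s (u, i) = (u, s i).
Proof. by rewrite permE. Qed.

Lemma blkM f f' : (blk f * blk f')%g = blk [ffun i => f i * f' i]%g.
Proof. by apply/permP=> -[u i]; rewrite permM !blkE ffunE permM. Qed.

Lemma blk1 : blk [ffun=> 1%g] = 1%g.
Proof. by apply/permP=> -[u i]; rewrite blkE ffunE !perm1. Qed.

Lemma topM s s' : (top s * top s')%g = top (s * s')%g.
Proof. by apply/permP=> -[u i]; rewrite permM !topE permM. Qed.

Lemma blkV f : (blk f)^-1%g = blk [ffun i => (f i)^-1]%g.
Proof.
apply/eqP; rewrite eq_invg_mul blkM -blk1; apply/eqP; congr blk.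
by apply/ffunP=> i; rewrite !ffunE mulgV.
Qed.

Lemma blkJ f f' : (blk f ^ blk f')%g = blk [ffun i => f i ^ f' i]%g.
Proof.
rewrite conjgE blkV !blkM; congr blk.
by apply/ffunP=> i; rewrite !ffunE conjgE.
Qed.

Lemma topV s : (top s)^-1%g = top s^-1%g.
Proof.
apply/eqP; rewrite eq_invg_mul topM mulgV; apply/eqP/permP=> -[u i].
by rewrite topE !perm1.
Qed.

Lemma blkJtop f s : (blk f ^ top s)%g = blk [ffun i => f (s^-1 i)]%g.
Proof.
apply/permP=> -[u i]; rewrite conjgE topV !permM topE !blkE topE.
by rewrite ffunE permKV.
Qed.

Lemma blk_inj : injective blk.
Proof.
move=> f f' eqf; apply/ffunP=> i; apply/permP=> u.
by have /permP/(_ (u, i)) := eqf; rewrite !blkE => -[].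
Qed.

Definition single i g : {ffun I -> {perm X}} := [ffun j => if j == i then g else 1%g].

Definition component (chi : {perm X * I} -> algC) i g := chi (blk (single i g)).

Definition power (P : {set {perm X}}) := [set blk f | f in ffun_on (mem P)].

Section Power.

Variable P : {group {perm X}}.

Lemma powerP g :
  reflect (exists2 f : {ffun I -> {perm X}}, (forall i, f i \in P) & g = blk f)
          (g \in power P).
Proof.
apply: (iffP imsetP) => [[f /ffun_onP Pf ->] | [f Pf ->]]; exists f => //.
exact/ffun_onP.
Qed.

Lemma mem_power f : (forall i, f i \in P) -> blk f \in power P.
Proof. by move=> Pf; apply/powerP; exists f. Qed.

Lemma power_group_set : group_set (power P).
Proof.
apply/group_setP; split=> [|_ _ /powerP[f Pf ->] /powerP[f' Pf' ->]].
  by rewrite -blk1 mem_power // => i; rewrite ffunE.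
by rewrite blkM mem_power // => i; rewrite ffunE groupM.
Qed.

Canonical power_group := Group power_group_set.

Lemma card_power : #|power P| = (#|P| ^ #|I|)%N.
Proof. by rewrite card_imset ?card_ffun_on //; apply: blk_inj. Qed.

Lemma mem_single i g : g \in P -> forall j, single i g j \in P.
Proof. by move=> Pg j; rewrite ffunE; case: ifP. Qed.

Lemma lin_component chi i : lin_on (power P) chi -> lin_on P (component chi i).
Proof.
move=> [chi1 chiM]; split=> [|g h Pg Ph].
  rewrite /component -chi1 -blk1; congr (chi (blk _)).
  by apply/ffunP=> j; rewrite !ffunE if_same.
rewrite /component -chiM ?mem_power //; try exact: mem_single.
rewrite blkM; congr (chi (blk _)); apply/ffunP=> j; rewrite !ffunE.
by case: eqP; rewrite ?mulg1.
Qed.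

Lemma lin_blk chi f : lin_on (power P) chi -> (forall i, f i \in P) ->
  chi (blk f) = \prod_i component chi i (f i).
Proof.
move=> lin_chi Pf.
have Pf1 (r : seq I) i : [ffun i => if i \in r then f i else 1%g] i \in P.
  by rewrite ffunE; case: ifP.
(* Induction on the list of coordinates already filled in, the others being trivial. *)
suff IH (r : seq I) : uniq r ->
    chi (blk [ffun i => if i \in r then f i else 1%g]) =
    \prod_(i <- r) component chi i (f i).
  rewrite -IH ?index_enum_uniq //; congr (chi (blk _)).
  by apply/ffunP=> i; rewrite ffunE mem_index_enum.
elim: r => [_|i r IHr /= /andP[r'i Ur]].
  rewrite big_nil -lin_chi.1 -blk1; congr (chi (blk _)).
rewrite big_cons -{}IHr // /component -lin_chi.2 ?mem_power //; last exact: mem_single.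
rewrite blkM; congr (chi (blk _)); apply/ffunP=> j; rewrite !ffunE in_cons.
by case: eqP => [->|_] /=; rewrite ?(negPf r'i) ?mulg1 ?mul1g.
Qed.

Lemma weight_blk p N f y : weight p N (blk f) y = \prod_i weight p N (f i) y.
Proof.
rewrite /weight exchange_big pair_big /=; apply: eq_bigr => -[u i] _ /=.
rewrite (@level_inj _ _ _ _ (pair^~ i) (f i)) => [//|v w []//|v].
exact: blkE.
Qed.

Lemma sum_ffun_prod (F : I -> {perm X} -> algC) :
  \sum_(f in ffun_on (mem P)) \prod_i F i (f i) = \prod_i \sum_(g in P) F i g.
Proof. by rewrite bigA_distr_big. Qed.

Lemma cycle_index_power p N chi y : lin_on (power P) chi ->
  cycle_index p N (power P) chi y = \prod_i cycle_index p N P (component chi i) y.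
Proof.
move=> lin_chi; rewrite -sum_ffun_prod /cycle_index big_imset /=; last first.
  by move=> f f' _ _; apply: blk_inj.
apply: eq_bigr => f /ffun_onP Pf; rewrite lin_blk // weight_blk.
by rewrite -big_split.
Qed.

Lemma blk_norm f : (forall i, f i \in 'N(P)) -> blk f \in 'N(power P).
Proof.
move=> Nf; rewrite inE; apply/subsetP=> _ /imsetP[_ /powerP[g Pg ->] ->].
by rewrite blkJ mem_power // => i; rewrite ffunE memJ_norm.
Qed.

Lemma top_norm s : top s \in 'N(power P).
Proof.
rewrite inE; apply/subsetP=> _ /imsetP[_ /powerP[g Pg ->] ->].
by rewrite blkJtop mem_power // => i; rewrite ffunE.
Qed.

(** The normaliser contains both the coordinatewise normalising elements and all permutations of the
    coordinates; the conjugating element combines the two. *)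
Lemma norm_conj_power chi xi s :
    lin_on (power P) chi -> lin_on (power P) xi ->
    (forall i, norm_conj P (component chi (s i)) (component xi i)) ->
  norm_conj (power P) chi xi.
Proof.
move=> lin_chi lin_xi /fin_all_exists2[t Nt conj_t].
exists (blk (finfun t) * top s)%g.
  by rewrite groupM ?top_norm ?blk_norm // => i; rewrite ffunE.
move=> _ /powerP[f Pf ->]; rewrite conjgM blkJ blkJtop !lin_blk // => [|i]; last first.
  by rewrite !ffunE memJ_norm.
rewrite [RHS](reindex_inj (@perm_inj _ s)); apply: eq_bigr => i _.
by rewrite conj_t // !ffunE permK.
Qed.

End Power.

End Blocks.

(** * Wreath products with the cyclic group of order p *)

Section Wreath.

Variables (p : nat) (X : finType).
Hypothesis p_pr : prime p.
Implicit Types (f : {ffun 'F_p -> {perm X}}) (b : 'F_p) (y : nat -> algC).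

Let p_gt0 : (0 < p)%N := prime_gt0 p_pr.
Let mulrn_p b : b *+ p = 0 := mulrn_pchar (pchar_Fp p_pr) b.
Let FpE b : b = (b : nat)%:R := esym (natr_Zp b).

Definition trans b : {perm 'F_p} := perm (addIr b).

Definition wr f b : {perm X * 'F_p} := (blk f * top X (trans b))%g.

Lemma wrE f b u i : wr f b (u, i) = (f i u, i + b).
Proof. by rewrite permM blkE topE permE. Qed.

Lemma wrM f b f' b' :
  (wr f b * wr f' b')%g = wr [ffun i => f i * f' (i + b)%R]%g (b + b').
Proof. by apply/permP=> -[u i]; rewrite permM !wrE ffunE permM addrA. Qed.

Lemma wr0 f : wr f 0 = blk f.
Proof. by apply/permP=> -[u i]; rewrite wrE blkE addr0. Qed.

(** The product of the entries met in [m] steps of length [b] from copy [i]: the action on that copy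
    of the [m]-th power of [wr f b]. *)
Definition walk m f b i : {perm X} := (\prod_(j < m) f (i + b *+ j)%R)%g.

Lemma walkSl m f b i : walk m.+1 f b i = (f i * walk m f b (i + b))%g.
Proof.
rewrite /walk big_ord_recl addr0; congr (_ * _)%g.
by apply: eq_bigr => j _; rewrite -addrA -mulrS.
Qed.

Lemma walkSr m f b i : walk m.+1 f b i = (walk m f b i * f (i + b *+ m)%R)%g.
Proof. by rewrite /walk big_ord_recr. Qed.

Lemma wrX f b m u i : (wr f b ^+ m)%g (u, i) = (walk m f b i u, i + b *+ m).
Proof.
elim: m => [|m IHm]; first by rewrite /walk !perm1 big_ord0 perm1 addr0.
by rewrite expgSr permM IHm wrE walkSr permM mulrSr addrA.
Qed.

(** After [p] steps the walk closes up, so starting one step later rotates the product cyclically,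
    which is a conjugation. *)
Lemma walkJ f b i : (walk p f b i ^ f i)%g = walk p f b (i + b).
Proof.
suff [Hl Hr] : walk p f b i = walk p.-1.+1 f b i /\
               walk p f b (i + b) = walk p.-1.+1 f b (i + b).
  rewrite Hl Hr walkSl walkSr conjgE !mulgA mulVg mul1g -addrA -mulrS.
  by rewrite prednK // mulrn_p addr0.
by rewrite prednK.
Qed.

Lemma weight_walk N f b i y : b != 0 ->
  weight p N (walk p f b i) y = weight p N (walk p f b 0) y.
Proof.
move=> nz_b; have -> : i = b *+ (i / b : 'F_p).
  by rewrite -mulr_natr -FpE mulrC divfK.
by elim: (i / b : nat) => // m IHm; rewrite mulrSr -walkJ weightJ.
Qed.

(** No point is fixed, so each level is one more than that for the [p]-th power, which acts on each
    of the [p] copies by a conjugate of the walk from 0. *)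
Lemma weight_wr N f b y : b != 0 ->
  weight p N.+1 (wr f b) y =
  weight p N (walk p f b 0) (fun j => shift y j ^+ p).
Proof.
move=> nz_b; rewrite /weight; set g := walk p f b.
have lvl u i : level p N.+1 (wr f b) (u, i) = (level p N (g i) u).+1.
  rewrite /= wrE xpair_eqE andbC -subr_eq0 addrC addKr (negPf nz_b) /=.
  congr _.+1; rewrite (@level_inj _ _ _ _ (pair^~ i) (g i)) // => [v w []//|v].
  by rewrite wrX mulrn_p addr0.
rewrite (eq_bigr (fun u => shift y (level p N (g u.2) u.1))) => [|[u i] _]; last first.
  by rewrite lvl.
rewrite -(pair_big predT predT (fun u i => shift y (level p N (g i) u))) /=.
rewrite exchange_big /=.
rewrite (eq_bigr (fun=> weight p N (g 0) (shift y))) => [|i _]; last first.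
  by rewrite -(weight_walk N f i).
by rewrite prodr_const card_Fp // -prodrXl.
Qed.

Definition wreath (P : {set {perm X}}) :=
  [set wr q.1 q.2 | q in setX [set f in ffun_on (mem P)] [set: 'F_p]].

Variable P : {group {perm X}}.

Lemma wreathP g :
  reflect (exists f b, (forall i, f i \in P) /\ g = wr f b) (g \in wreath P).
Proof.
apply: (iffP imsetP) => [[[f b] /setXP[/=]]|[f [b [Pf ->]]]].
  by rewrite inE => /ffun_onP Pf _ ->; exists f, b.
by exists (f, b); rewrite // !inE andbT; apply/ffun_onP.
Qed.

Lemma mem_wreath f b : (forall i, f i \in P) -> wr f b \in wreath P.
Proof. by move=> Pf; apply/wreathP; exists f, b. Qed.

Lemma wreath_group_set : group_set (wreath P).
Proof.
apply/group_setP; split=> [|_ _ /wreathP[f [b [Pf ->]]] /wreathP[f' [b' [Pf' ->]]]].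
  by rewrite -blk1 -wr0 mem_wreath // => i; rewrite ffunE.
by rewrite wrM mem_wreath // => i; rewrite ffunE groupM.
Qed.

Canonical wreath_group := Group wreath_group_set.

Hypothesis X_gt0 : (0 < #|X|)%N.

Lemma wr_inj f f' b b' : wr f b = wr f' b' -> f = f' /\ b = b'.
Proof.
move/permP=> eq_wr; have /card_gt0P[u0 _] := X_gt0; split.
  by apply/ffunP=> i; apply/permP=> u; have := eq_wr (u, i); rewrite !wrE => -[].
by have := eq_wr (u0, 0); rewrite !wrE !add0r => -[].
Qed.

Lemma wr_uncurry_inj : injective (fun q : {ffun 'F_p -> {perm X}} * 'F_p => wr q.1 q.2).
Proof. by move=> [f b] [f' b'] /wr_inj[/= -> ->]. Qed.

Lemma card_wreath : #|wreath P| = (#|P| ^ p * p)%N.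
Proof.
rewrite card_imset; last exact: wr_uncurry_inj.
by rewrite cardsX cardsE card_ffun_on cardsT !card_Fp.
Qed.

Lemma sum_wreath (F : {perm X * 'F_p} -> algC) :
  \sum_(g in wreath P) F g =
  \sum_b \sum_(f in ffun_on (mem P)) F (wr f b).
Proof.
rewrite big_imset /=; last by move=> q q' _ _; apply: wr_uncurry_inj.
rewrite exchange_big pair_big /=; apply: eq_big => [[f b]|[f b] _] //.
by rewrite !inE.
Qed.

(* Translating [f 0] by [h \in P] translates the product by [h]: averaging over
   [h] shows that the product is equidistributed in [P]. *)
Lemma sum_walk (F : {perm X} -> algC) b : b != 0 ->
  \sum_(f in ffun_on (mem P)) F (walk p f b 0) =
  (#|P| ^ p.-1)%:R * \sum_(h in P) F h.
Proof.
move=> nz_b.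
pose tr h f : {ffun 'F_p -> {perm X}} :=
  [ffun i => if i == 0 then h * f i else f i]%g.
have trK h : cancel (tr h) (tr h^-1%g).
  by move=> f; apply/ffunP=> i; rewrite !ffunE; case: eqP; rewrite ?mulKg.
have tr_inj h : injective (tr h) := can_inj (trK h).
have tr_on h f : h \in P -> (tr h f \in ffun_on (mem P)) = (f \in ffun_on (mem P)).
  move=> Ph; apply/ffun_onP/ffun_onP=> Pf i; last first.
    by rewrite ffunE; case: eqP => _; rewrite ?groupM //; apply: Pf.
  by have := Pf i; rewrite ffunE; case: eqP => _ //; rewrite groupMl.
(* Coordinate 0 is met only at the first step, since [b *+ j] is nonzero for 0 < j < p. *)
have walk_tr h f : walk p (tr h f) b 0 = (h * walk p f b 0)%g.
  suff Hp f' : walk p f' b 0 = walk p.-1.+1 f' b 0.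
    rewrite !Hp !walkSl mulgA {1}/tr ffunE eqxx; congr (_ * _)%g.
    apply: eq_bigr => j _; rewrite ffunE add0r -mulrS -mulr_natr mulf_eq0.
    rewrite (negPf nz_b) -(dvdn_pcharf (pchar_Fp p_pr)) gtnNdvd //.
    by rewrite -[p in (_ < p)%N](prednK p_gt0) ltnS.
  by rewrite prednK.
have nzP : #|P|%:R != 0 :> algC by rewrite pnatr_eq0 -lt0n cardG_gt0.
apply: (mulfI nzP); rewrite mulrA -natrM -expnS prednK //.
transitivity (\sum_(h in P) \sum_(f in ffun_on (mem P)) F (walk p (tr h f) b 0)).
  rewrite mulr_natl -sumr_const; apply: eq_bigr => h Ph.
  rewrite [LHS](reindex_inj (@tr_inj h)); apply: eq_bigl => f.
  exact: tr_on.
pose B : simpl_pred {ffun 'F_p -> {perm X}} := ffun_on (mem P).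
have <- : #|B| = (#|P| ^ p)%N.
  by rewrite card_ffun_on card_Fp.
rewrite exchange_big /= -sum1_card natr_sum mulr_suml.
apply: eq_bigr => f /ffun_onP Pf; rewrite mul1r.
have Pw : walk p f b 0 \in P by rewrite group_prod.
rewrite [RHS](reindex_inj (@mulIg _ (walk p f b 0))); apply: eq_big => [h|h _].
  by rewrite groupMr.
by rewrite walk_tr.
Qed.

Section LinearOnWreath.

Variable chi : {perm X * 'F_p} -> algC.
Hypothesis lin_chi : lin_on (wreath P) chi.

Definition base_char g := chi (wr (single 0 g) 0).
Definition top_char b := chi (wr [ffun=> 1%g] b).

Let wr1_in b : wr [ffun=> 1%g] b \in wreath P.
Proof. by apply: mem_wreath => i; rewrite ffunE. Qed.

Lemma top_charD b b' : top_char (b + b') = top_char b * top_char b'.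
Proof.
rewrite /top_char -lin_chi.2 // wrM; congr (chi (wr _ _)).
by apply/ffunP=> i; rewrite !ffunE mulg1.
Qed.

Lemma top_char0 : top_char 0 = 1.
Proof. by rewrite /top_char wr0 blk1 lin_chi.1. Qed.

Lemma top_char_neq0 b : top_char b != 0.
Proof. exact: lin_on_neq0 lin_chi (wr1_in b). Qed.

Lemma top_charMn b m : top_char (b *+ m) = top_char b ^+ m.
Proof.
by elim: m => [|m IHm]; rewrite ?top_char0 // mulrS top_charD IHm exprS.
Qed.

Lemma top_charE b : top_char b = top_char 1 ^+ b.
Proof. by rewrite -top_charMn -FpE. Qed.

Lemma lin_base_char : lin_on (power 'F_p P) chi.
Proof.
split=> [|_ _ /powerP[f Pf ->] /powerP[f' Pf' ->]]; first exact: lin_chi.1.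
by rewrite -!wr0 lin_chi.2 ?mem_wreath.
Qed.

(** Translations conjugate coordinate [i] to coordinate 0, and linear characters are constant on
    conjugates. *)
Lemma component_wreath i g : g \in P -> component chi i g = base_char g.
Proof.
move=> Pg; apply: (mulIf (top_char_neq0 i)).
have Ps j : wr (single j g) 0 \in wreath P.
  by apply: mem_wreath => k; apply: mem_single.
rewrite mulrC /component /base_char /top_char -wr0 -!lin_chi.2 //.
rewrite !wrM addr0 add0r; congr (chi (wr _ _)); apply/ffunP=> j; rewrite !ffunE.
by rewrite mul1g mulg1 -subr_eq0 addrK.
Qed.

Lemma lin_wr f b : (forall i, f i \in P) ->
  chi (wr f b) = \prod_i base_char (f i) * top_char b.
Proof.
move=> Pf; have -> : wr f b = (wr f 0 * wr [ffun=> 1%g] b)%g.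
  by rewrite wrM add0r; congr wr; apply/ffunP=> i; rewrite !ffunE mulg1.
rewrite lin_chi.2 ?wr1_in ?mem_wreath // wr0 (lin_blk lin_base_char) //; congr (_ * _).
by apply: eq_bigr => i _; rewrite component_wreath.
Qed.

Lemma lin_on_base : lin_on P base_char.
Proof.
have [lin1 linM] := lin_component 0 lin_base_char.
split=> [|g h Pg Ph]; first by rewrite -(component_wreath 0) // lin1.
by rewrite -!(component_wreath 0) ?groupM ?linM.
Qed.

(** A nontrivial character of the top group sums to 0, and the term at 0 is 1. *)
Lemma sum_top_char :
  \sum_(b | b != 0) top_char b = if top_char 1 == 1 then p.-1%:R else -1.
Proof.
case: eqP => [top1|/eqP top1].
  rewrite (eq_bigr (fun=> 1)) => [|b _]; last by rewrite top_charE top1 expr1n.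
  have <- : #|'F_p|.-1 = p.-1 by rewrite card_Fp.
  by rewrite sumr_const -(cardC1 (0 : 'F_p)).
have: (top_char 1 - 1) * \sum_b top_char b = 0.
  rewrite mulrBl mul1r mulr_sumr [X in _ - X](reindex_inj (addrI 1)) /=.
  by apply/eqP; rewrite subr_eq0; apply/eqP/eq_bigr => b _; rewrite top_charD.
move/eqP; rewrite mulf_eq0 subr_eq0 (negPf top1) (bigD1 0) //= top_char0.
by rewrite addrC addr_eq0 => /eqP.
Qed.

(** The base group, [b = 0], gives the [p]-th power. For [b != 0] the weight and the base part of
    the character depend only on the walk from 0, which is equidistributed in [P], so [b] enters
    through [top_char b] alone. *)
Lemma cycle_index_wreath N y :
  cycle_index p N.+1 (wreath P) chi y =
  cycle_index p N.+1 P base_char y ^+ p +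
  (if top_char 1 == 1 then p.-1%:R else -1) * (#|P| ^ p.-1)%:R *
  cycle_index p N P base_char (fun j => shift y j ^+ p).
Proof.
rewrite {1}/cycle_index sum_wreath (bigD1 0) //=; congr (_ + _).
  have <- : \prod_(i : 'F_p) cycle_index p N.+1 P base_char y =
            cycle_index p N.+1 P base_char y ^+ p by rewrite prodr_const card_Fp.
  rewrite -sum_ffun_prod.
  apply: eq_bigr => f /ffun_onP Pf; rewrite lin_wr // top_char0 mulr1 wr0.
  by rewrite weight_blk -big_split.
rewrite -sum_top_char -mulrA mulr_suml; apply: eq_bigr => b nz_b.
rewrite -(sum_walk _ nz_b) mulr_sumr; apply: eq_bigr => f /ffun_onP Pf.
rewrite weight_wr // lin_wr // mulrA; congr (_ * _); rewrite mulrC; congr (_ * _).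
rewrite (@lin_on_prod _ P base_char _ _ _ _ lin_on_base) //=.
(* The multiples of [b] run through F_p, so the walk collects every coordinate exactly once. *)
have stepK (j : 'I_p) : ((0 + b *+ j) / b : 'F_p) = j :> nat.
  by rewrite add0r -mulr_natl mulfK // val_Fp_nat // modn_small.
rewrite (reindex (fun j : 'I_p => 0 + b *+ j)) //=.
apply/onW_bij/inj_card_bij; last by rewrite card_Fp // card_ord.
by move=> j k /= eq_jk; apply: val_inj; rewrite -[LHS]stepK eq_jk stepK.
Qed.

End LinearOnWreath.

(** Multiplication by a nonzero [a] normalises the translations of F_p, hence carries any nontrivial
    character of the top group to any other, while [t] acts in every coordinate of the base. *)
Lemma norm_conj_wreath chi xi :
    lin_on (wreath P) chi -> lin_on (wreath P) xi ->
    norm_conj P (base_char chi) (base_char xi) ->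
    (top_char chi 1 == 1) = (top_char xi 1 == 1) ->
  norm_conj (wreath P) chi xi.
Proof.
move=> lin_chi lin_xi [t Nt conj_t] eq_top.
have [a nz_a top_a] : exists2 a, a != 0 & forall b, top_char xi b = top_char chi (a * b).
  have [top1|ntop1] := eqVneq (top_char chi 1) 1.
    move: eq_top; rewrite top1 eqxx => /esym/eqP top1'.
    exists 1 => [|b]; first exact: oner_neq0.
    by rewrite mul1r (top_charE lin_chi) (top_charE lin_xi) top1 top1'.
  have ntop1' : top_char xi 1 != 1 by rewrite -eq_top.
  have top_p eta : lin_on (wreath P) eta -> top_char eta 1 ^+ p = 1.
    by move=> lin_eta; rewrite -top_charMn // mulrn_p top_char0.
  (* The value of [chi] at the top generator is a primitive [p]-th root of unity; that of [xi] is
     its [i]-th power, and [a] is [i] modulo [p]. *)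
  have [m prim_m dv_m] := prim_order_exists p_gt0 (top_p _ lin_chi).
  have Dm : m = p.
    case/primeP: p_pr => _ /(_ m dv_m) /pred2P[] // m1.
    by move: (prim_expr_order prim_m) ntop1; rewrite m1 expr1 => ->; rewrite eqxx.
  rewrite Dm in prim_m; have [i Di] := prim_rootP prim_m (top_p _ lin_xi).
  exists i%:R => [|b].
    apply: contraNneq ntop1' => i0; rewrite Di.
    by rewrite -(top_charMn lin_chi) -mulr_natr i0 mulr0 top_char0.
  by rewrite mulr_natl top_charMn // (top_charE lin_xi) Di -exprM mulnC exprM -top_charE.
pose s := perm (mulfI nz_a).
have conjE f b : (wr f b ^ (blk [ffun=> t] * top X s))%g =
    wr [ffun i => f (s^-1%g i) ^ t]%g (a * b).
  apply: (mulgI (blk [ffun=> t] * top X s)%g); rewrite conjgE !mulgA mulgV mul1g.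
  apply/permP=> -[u i]; rewrite !permM !(wrE, blkE, topE) !ffunE permK permJ.
  by rewrite !permE mulrDr.
exists (blk [ffun=> t] * top X s)%g.
  rewrite inE; apply/subsetP=> _ /imsetP[_ /wreathP[f [b [Pf ->]]] ->].
  by rewrite conjE mem_wreath // => i; rewrite ffunE memJ_norm.
move=> _ /wreathP[f [b [Pf ->]]]; rewrite conjE !lin_wr //; last first.
  by move=> i; rewrite ffunE memJ_norm.
rewrite top_a; congr (_ * _); rewrite [RHS](reindex_inj (@perm_inj _ s)).
by apply: eq_bigr => i _; rewrite ffunE permK conj_t.
Qed.

End Wreath.

(** * Direct products acting on disjoint unions *)

Section DisjointSum.

Variables X Y : finType.
Implicit Types (g : {perm X}) (h : {perm Y}).

Lemma dsum_subproof g h :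
  injective (fun u : X + Y => match u with inl a => inl (g a) | inr b => inr (h b) end).
Proof. by move=> [a|b] [a'|b'] // [/perm_inj->]. Qed.

Definition dsum g h : {perm X + Y} := perm (@dsum_subproof g h).

Lemma dsumEl g h a : dsum g h (inl a) = inl (g a).
Proof. by rewrite permE. Qed.

Lemma dsumEr g h b : dsum g h (inr b) = inr (h b).
Proof. by rewrite permE. Qed.

Lemma dsumM g h g' h' : (dsum g h * dsum g' h')%g = dsum (g * g')%g (h * h')%g.
Proof. by apply/permP=> -[a|b]; rewrite permM !(dsumEl, dsumEr) permM. Qed.

Lemma dsum1 : dsum 1 1 = 1%g.
Proof. by apply/permP=> -[a|b]; rewrite (dsumEl, dsumEr) !perm1. Qed.

Lemma dsumJ g h g' h' : (dsum g h ^ dsum g' h')%g = dsum (g ^ g')%g (h ^ h')%g.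
Proof.
by apply: (mulgI (dsum g' h')); rewrite conjgE !mulgA mulgV mul1g !dsumM -!conjgC.
Qed.

Lemma dsum_inj g h g' h' : dsum g h = dsum g' h' -> g = g' /\ h = h'.
Proof.
move/permP=> eq_gh; split; apply/permP=> u.
  by have := eq_gh (inl u); rewrite !dsumEl => -[].
by have := eq_gh (inr u); rewrite !dsumEr => -[].
Qed.

Lemma dsum_uncurry_inj : injective (fun q : {perm X} * {perm Y} => dsum q.1 q.2).
Proof. by move=> [g h] [g' h'] /dsum_inj[/= -> ->]. Qed.

Definition dsum_set (P : {set {perm X}}) (Q : {set {perm Y}}) :=
  [set dsum q.1 q.2 | q in setX P Q].

Variables (P : {group {perm X}}) (Q : {group {perm Y}}).

Lemma dsum_setP k :
  reflect (exists g h, [/\ g \in P, h \in Q & k = dsum g h]) (k \in dsum_set P Q).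
Proof.
apply: (iffP imsetP) => [[[g h] /setXP[/= Pg Qh] ->]|[g [h [Pg Qh ->]]]].
  by exists g, h.
by exists (g, h); rewrite // inE Pg.
Qed.

Lemma mem_dsum g h : g \in P -> h \in Q -> dsum g h \in dsum_set P Q.
Proof. by move=> Pg Qh; apply/dsum_setP; exists g, h. Qed.

Lemma dsum_group_set : group_set (dsum_set P Q).
Proof.
apply/group_setP; split; first by rewrite -dsum1 mem_dsum.
move=> _ _ /dsum_setP[g [h [Pg Qh ->]]] /dsum_setP[g' [h' [Pg' Qh' ->]]].
by rewrite dsumM mem_dsum ?groupM.
Qed.

Canonical dsum_group := Group dsum_group_set.

Lemma card_dsum : #|dsum_set P Q| = (#|P| * #|Q|)%N.
Proof. by rewrite card_imset ?cardsX //; apply: dsum_uncurry_inj. Qed.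

Definition left_char (chi : {perm X + Y} -> algC) g := chi (dsum g 1).
Definition right_char (chi : {perm X + Y} -> algC) h := chi (dsum 1 h).

Section LinearOnSum.

Variable chi : {perm X + Y} -> algC.
Hypothesis lin_chi : lin_on (dsum_set P Q) chi.

Lemma lin_left : lin_on P (left_char chi).
Proof.
split=> [|g h Pg Ph]; first by rewrite /left_char dsum1 lin_chi.1.
by rewrite /left_char -lin_chi.2 ?mem_dsum // dsumM mulg1.
Qed.

Lemma lin_right : lin_on Q (right_char chi).
Proof.
split=> [|g h Qg Qh]; first by rewrite /right_char dsum1 lin_chi.1.
by rewrite /right_char -lin_chi.2 ?mem_dsum // dsumM mulg1.
Qed.

Lemma lin_dsum g h : g \in P -> h \in Q ->
  chi (dsum g h) = left_char chi g * right_char chi h.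
Proof.
move=> Pg Qh; rewrite /left_char /right_char -lin_chi.2 ?mem_dsum //.
by rewrite dsumM mulg1 mul1g.
Qed.

Lemma cycle_index_dsum p N y :
  cycle_index p N (dsum_set P Q) chi y =
  cycle_index p N P (left_char chi) y * cycle_index p N Q (right_char chi) y.
Proof.
rewrite /cycle_index big_imset /=; last by move=> q q' _ _; apply: dsum_uncurry_inj.
rewrite mulr_suml; under [RHS]eq_bigr do rewrite mulr_sumr.
rewrite pair_big_dep /=; apply: eq_big => [[g h]|[g h]]; rewrite ?inE //=.
case/andP=> Pg Qh; rewrite lin_dsum // mulrACA; congr (_ * _).
rewrite /weight big_sumType /=; congr (_ * _); apply: eq_bigr => u _.
  by rewrite (@level_inj _ _ _ _ inl g) // => [v w []//|v]; rewrite dsumEl.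
by rewrite (@level_inj _ _ _ _ inr h) // => [v w []//|v]; rewrite dsumEr.
Qed.

End LinearOnSum.

Lemma norm_conj_dsum chi xi :
    lin_on (dsum_set P Q) chi -> lin_on (dsum_set P Q) xi ->
    norm_conj P (left_char chi) (left_char xi) ->
    norm_conj Q (right_char chi) (right_char xi) ->
  norm_conj (dsum_set P Q) chi xi.
Proof.
move=> lin_chi lin_xi [s Ns conj_s] [t Nt conj_t]; exists (dsum s t).
  rewrite inE; apply/subsetP=> _ /imsetP[_ /dsum_setP[g [h [Pg Qh ->]]] ->].
  by rewrite dsumJ mem_dsum ?memJ_norm.
move=> _ /dsum_setP[g [h [Pg Qh ->]]].
by rewrite dsumJ !lin_dsum ?memJ_norm // conj_s // conj_t.
Qed.

End DisjointSum.

(** * Sylow subgroups of symmetric groups *)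

Section FactorialPart.

Variable p : nat.
Hypothesis p_pr : prime p.
Let p_gt1 := prime_gt1 p_pr.

(** Legendre's formula, cut at any exponent beyond which the quotients vanish, so that sums for
    different numbers can be compared termwise. *)
Lemma logn_fact_trunc m n : (n < p ^ m)%N ->
  logn p n`! = (\sum_(1 <= k < m.+1) n %/ p ^ k)%N.
Proof.
move=> lt_n.
have trunc m1 m2 : (n < p ^ m1)%N -> (m1 <= m2)%N ->
  (\sum_(1 <= k < m2.+1) n %/ p ^ k = \sum_(1 <= k < m1.+1) n %/ p ^ k)%N.
  move=> lt1 le12; rewrite (@big_cat_nat _ _ _ m1.+1) //= [X in (_ + X)%N]big_nat.
  rewrite [X in (_ + X)%N]big1 ?addn0 // => k /andP[lt_k _].
  by rewrite divn_small // (leq_trans lt1) // leq_exp2l // ltnW.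
have lt_nn : (n < p ^ n)%N by exact: ltn_expl.
rewrite logn_fact // -(trunc n (maxn n m)) ?leq_maxl //.
by rewrite -(trunc m (maxn n m)) ?leq_maxr.
Qed.

Lemma logn_fact_digit K a r : (a < p)%N -> (r < p ^ K)%N ->
  logn p (a * p ^ K + r)`! = (a * logn p (p ^ K)`! + logn p r`!)%N.
Proof.
move=> lt_a lt_r; have p_gt0 := ltnW p_gt1.
have lt_rS : (r < p ^ K.+1)%N by rewrite (leq_trans lt_r) // leq_exp2l.
have lt_K : (p ^ K < p ^ K.+1)%N by rewrite ltn_exp2l.
have lt_n : (a * p ^ K + r < p ^ K.+1)%N.
  rewrite expnS (@leq_trans (a.+1 * p ^ K)) //; last by rewrite leq_mul2r lt_a orbT.
  by rewrite mulSn addnC ltn_add2r.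
rewrite !(@logn_fact_trunc K.+1) // [in RHS]big_distrr /= -big_split /=.
rewrite big_nat_recr //= [in RHS]big_nat_recr //=.
rewrite (divn_small lt_n) (divn_small lt_rS) (divn_small lt_K) muln0 !addn0.
apply: eq_big_nat => k /andP[_ le_k].
rewrite ltnS in le_k.
by rewrite -{1 2}(subnK le_k) expnD mulnA divnMDl ?mulnK ?expn_gt0 ?p_gt0.
Qed.

Lemma logn_fact_pow k :
  logn p (p ^ k.+1)`! = (p * logn p (p ^ k)`! + 1)%N.
Proof.
have p_gt0 := ltnW p_gt1.
rewrite (@logn_fact_trunc k.+2) ?ltn_exp2l // (@logn_fact_trunc k.+1) ?ltn_exp2l //.
rewrite big_nat_recr //= divn_small ?ltn_exp2l // addn0.
rewrite big_nat_recr //= divnn expn_gt0 p_gt0.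
rewrite [in RHS]big_nat_recr //= [in RHS]divn_small ?ltn_exp2l // addn0 big_distrr /=.
congr (_ + _)%N; apply: eq_big_nat => j /andP[_ le_j].
rewrite ltnS in le_j.
by rewrite expnS -{1 2}(subnK le_j) expnD mulnA ?mulnK ?expn_gt0 ?p_gt0.
Qed.

Lemma part_fact_digit K a r : (a < p)%N -> (r < p ^ K)%N ->
  ((a * p ^ K + r)`!`_p = (p ^ K)`!`_p ^ a * r`!`_p)%N.
Proof.
by move=> lt_a lt_r; rewrite !p_part logn_fact_digit // expnD mulnC mulnC expnM expnAC.
Qed.

Lemma part_fact_pow k : ((p ^ k.+1)`!`_p = (p ^ k)`!`_p ^ p * p)%N.
Proof. by rewrite !p_part logn_fact_pow expnD expn1 mulnC expnM expnAC mulnC. Qed.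

End FactorialPart.

(** * Iterated wreath products and their assembly along base-p digits *)

Section Towers.

Variable p : nat.
Hypothesis p_pr : prime p.
Let p_gt1 := prime_gt1 p_pr.

(* The factor [p.-1] or [-1] is the sum of a linear character of [C_p] over the
   non-identity elements, the character being trivial if [c]; the other one is the fibre size in [sum_walk]. *)
Definition top_coef (c : bool) k : algC :=
  (if c then p.-1%:R else -1) * ((p ^ k)`!`_p ^ p.-1)%:R.

Lemma top_coef_scale_neq0 k : ((p ^ k)`!`_p ^ p.-1)%:R != 0 :> algC.
Proof. by rewrite pnatr_eq0 -lt0n expn_gt0 part_gt0. Qed.

Lemma top_coef_neq0 c k : top_coef c k != 0.
Proof.
rewrite mulf_neq0 ?top_coef_scale_neq0 //; case: c; last by rewrite oppr_eq0 oner_eq0.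
by rewrite pnatr_eq0 -lt0n -ltnS prednK // ltnW.
Qed.

Lemma top_coef_inj k : injective (top_coef^~ k).
Proof.
have ne : (p.-1%:R : algC) != -1 by rewrite -addr_eq0 natr1 pnatr_eq0.
move=> [] [] // /(mulIf (top_coef_scale_neq0 k))/= /eqP; last rewrite eq_sym.
  by rewrite (negPf ne).
by rewrite (negPf ne).
Qed.

Let zp := zpol p top_coef.

Definition pth_powers (y : nat -> algC) : nat -> algC := fun j => y j ^+ (p ^ j).

(** Identities known only at points of the form [pth_powers y] thus hold everywhere. *)
Lemma zpol_pth_roots x : exists y, forall e, zp e (pth_powers y) = zp e x.
Proof.
exists (fun j => (p ^ j).-root (x j)) => e.
apply: eq_zpol => j _.
by rewrite /pth_powers rootCK // expn_gt0 ltnW.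
Qed.

Definition has_type (X : finType) (P : {set {perm X}}) chi (e : seq bool) :=
  forall N y, (size e <= N)%N -> cycle_index p N P chi y = zp e (pth_powers y).

(** The group is the [k]-fold iterated wreath product. Its order will show that it gives Sylow
    subgroups; the conjugacy step of the induction needs the base characters to share a type, hence
    that types can be read off cycle indices. *)
Lemma tower_exists k : exists (X : finType) (P : {group {perm X}}),
  [/\ #|X| = (p ^ k)%N, #|P| = ((p ^ k)`!`_p)%N,
      forall chi, lin_on P chi -> exists2 e, size e = k & has_type P chi e
    & forall chi xi e, lin_on P chi -> lin_on P xi ->
        has_type P chi e -> has_type P xi e -> norm_conj P chi xi].
Proof.
elim: k => [|k [X [P [cardX cardP typeP conjP]]]].
  exists unit, 1%G; split; rewrite ?card_unit ?cards1 ?expn0 //.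
  - by rewrite p_part logn1.
  - move=> chi [chi1 _]; exists [::] => // N y _.
    rewrite /cycle_index big_set1 chi1 mul1r /weight /pth_powers /zp /= expr1.
    rewrite (big_pred1 tt) => [|[]//]; congr y.
    by case: N => //= N; rewrite perm1 eqxx.
  move=> chi xi e [chi1 _] [xi1 _] _ _; exists 1%g => [|g /set1P->]; first exact: group1.
  by rewrite conjg1 chi1 xi1.
have X_gt0 : (0 < #|X|)%N by rewrite cardX expn_gt0 ltnW.
(* The new head is [true] when [chi] is trivial on the top group; the exponent [p] on [shift y]
   matches the shift of [pth_powers y]. *)
have typeW chi (e : seq bool) : lin_on (wreath p P) chi ->
    has_type P (base_char chi) e -> size e = k ->
  has_type (wreath p P) chi ((top_char chi 1 == 1) :: e).
  move=> lin_chi type_e sz_e [//|N] y /=; rewrite ltnS => le_e.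
  rewrite cycle_index_wreath // !type_e ?leqW // cardP sz_e; congr (_ + _ * _).
  apply: eq_zpol => j _.
  by rewrite /pth_powers /shift -exprM expnS.
have linW chi : lin_on (wreath p P) chi -> lin_on P (base_char chi).
  by move=> lin_chi; apply: lin_on_base.
exists (X * 'F_p)%type, (wreath_group p P); split=> /=.
- by rewrite card_prod cardX card_Fp // expnS mulnC.
- by rewrite card_wreath // cardP part_fact_pow.
- move=> chi lin_chi; have [e sz_e type_e] := typeP _ (linW _ lin_chi).
  by exists ((top_char chi 1 == 1) :: e); [rewrite /= sz_e | apply: typeW].
move=> chi xi e0 lin_chi lin_xi type_chi type_xi.
have [e sz_e type_e] := typeP _ (linW _ lin_chi).
have [e' sz_e' type_e'] := typeP _ (linW _ lin_xi).
(* The words built for [chi] and [xi] are compared through the common type [e0], at an [N] large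
   enough for all three. *)
have eq_z x : zp ((top_char chi 1 == 1) :: e) x = zp ((top_char xi 1 == 1) :: e') x.
  have [y zy] := zpol_pth_roots x; rewrite -!zy.
  pose N := maxn k.+1 (size e0).
  have le_kN : (k < N)%N by rewrite leq_maxl.
  rewrite -(typeW chi e lin_chi type_e sz_e N) -?(typeW xi e' lin_xi type_e' sz_e' N).
  - by rewrite type_chi ?type_xi ?leq_maxr.
  - by rewrite /= sz_e'.
  by rewrite /= sz_e.
have sz1 (c : bool) (f : seq bool) :
  size f = k -> all (fun e => size e == k.+1) [:: c :: f].
  by move=> /= ->; rewrite eqxx.
(* With a single factor on each side, the comparison forces the two words to coincide. *)
have [x|] := @prod_zpol_top _ _ p_gt1 top_coef_neq0 top_coef_inj k.+1 _ _ [::] [::]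
  (sz1 (top_char chi 1 == 1) _ sz_e) (sz1 (top_char xi 1 == 1) _ sz_e') isT isT.
  by rewrite !big_seq1 !big_nil !mulr1; apply: eq_z.
move=> /perm_small_eq/= /(_ isT)[eq_top eq_e] _.
apply: (norm_conj_wreath p_pr) => //; apply: (conjP _ _ e) => //; try exact: linW.
by rewrite eq_e.
Qed.

(** Induction splits off the leading base-[p] digit, n = a p^K + r: [a] copies of the tower on p^K
    points beside a model for [r]. Words of length [K] come from the copies and shorter ones from
    the rest, so the cycle index tells them apart. *)
Lemma sylow_model K n : (n < p ^ K)%N -> exists (X : finType) (P : {group {perm X}}),
  [/\ #|X| = n, #|P| = (n`!`_p)%N,
      forall chi, lin_on P chi -> exists2 R, all (fun e => size e < K)%N R &
        forall N y, (K <= N)%N ->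
          cycle_index p N P chi y = \prod_(e <- R) zp e (pth_powers y)
    & forall chi xi, lin_on P chi -> lin_on P xi ->
        (forall N y, (K <= N)%N -> cycle_index p N P chi y = cycle_index p N P xi y) ->
      norm_conj P chi xi].
Proof.
elim: K n => [|K IHK] n lt_n.
  have -> : n = 0%N by apply/eqP; rewrite -leqn0 -ltnS.
  exists void, 1%G; split; rewrite ?card_void ?cards1 //.
  - by rewrite p_part logn1.
  - move=> chi [chi1 _]; exists [::] => // N y _.
    by rewrite /cycle_index big_set1 chi1 mul1r /weight big_nil big_pred0 // => -[].
  move=> chi xi [chi1 _] [xi1 _] _; exists 1%g => [|g /set1P->]; first exact: group1.
  by rewrite conjg1 chi1 xi1.
have p_gt0 := ltnW p_gt1.
set a := (n %/ p ^ K)%N; set r := (n %% p ^ K)%N.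
have lt_r : (r < p ^ K)%N by rewrite ltn_mod expn_gt0 p_gt0.
have lt_a : (a < p)%N by rewrite ltn_divLR ?expn_gt0 ?p_gt0 // -expnS.
have [X [P [cardX cardP typeP conjP]]] := tower_exists K.
have [Y [Q [cardY cardQ typeQ conjQ]]] := IHK r lt_r.
have type_sum chi : lin_on (dsum_set (power 'I_a P) Q) chi ->
  exists (t : a.-tuple (seq bool)) R,
  [/\ all (fun e => size e == K) t, all (fun e => size e < K)%N R,
      forall i, has_type P (component (left_char chi) i) (tnth t i),
      forall N y, (K <= N)%N -> cycle_index p N Q (right_char chi) y =
        \prod_(e <- R) zp e (pth_powers y)
    & forall N y, (K <= N)%N -> cycle_index p N (dsum_set (power 'I_a P) Q) chi y =
        \prod_(e <- t) zp e (pth_powers y) * \prod_(e <- R) zp e (pth_powers y)].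
  move=> lin_chi; have linL := lin_left lin_chi.
  have [R ltR typeR] := typeQ _ (lin_right lin_chi).
  have /fin_all_exists2[e sz_e type_e] i := typeP _ (lin_component i linL).
  exists [tuple e i | i < a], R; split=> //.
  - by apply/allP=> _ /mapP[i _ ->]; rewrite sz_e.
  - by move=> i; rewrite tnth_mktuple.
  move=> N y le_K; rewrite cycle_index_dsum // typeR // cycle_index_power //.
  rewrite big_map big_enum /=; congr (_ * _); apply: eq_bigr => i _.
  by rewrite type_e // sz_e.
exists (X * 'I_a + Y)%type, (dsum_group (power_group 'I_a P) Q); split=> /=.
- by rewrite card_sum card_prod card_ord cardX cardY mulnC -divn_eq.
- rewrite card_dsum card_power card_ord cardP cardQ -part_fact_digit //.
  by rewrite -divn_eq.
- move=> chi /type_sum[t [R [szt szR _ _ typechi]]]; exists (t ++ R).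
    rewrite all_cat (sub_all _ szR) => [|e /leqW //]; rewrite andbT.
    by apply: sub_all szt => e /eqP->.
  by move=> N y /ltnW le_K; rewrite typechi // big_cat.
move=> chi xi lin_chi lin_xi eqC.
have [t [R [szt szR type_t type_R type_chi]]] := type_sum chi lin_chi.
have [t' [R' [szt' szR' type_t' type_R' type_xi]]] := type_sum xi lin_xi.
have eq_prod F y x : (forall e, zp e (pth_powers y) = zp e x) ->
  \prod_(e <- F) zp e (pth_powers y) = \prod_(e <- F) zp e x.
  by move=> zy; apply: eq_bigr.
have [x|perm_t eqR] := prod_zpol_top p_gt1 top_coef_neq0 top_coef_inj szt szt' szR szR'.
  have [y zy] := zpol_pth_roots x; have := eqC K.+1 y (leqnn _).
  by rewrite type_chi // type_xi // !(eq_prod _ _ _ zy).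
apply: norm_conj_dsum => //; last first.
  apply: (conjQ _ _ (lin_right lin_chi) (lin_right lin_xi)) => N y le_K.
  by rewrite type_R // type_R'.
(* Equal multisets of words give a permutation [s] of the [a] copies that matches the types. *)
rewrite perm_sym in perm_t; have /tuple_permP[s Dt'] := perm_t.
have linL := lin_left lin_chi; have linL' := lin_left lin_xi.
apply: (@norm_conj_power _ _ _ _ _ s) => [||i] //.
have eq_t' : tnth t' i = tnth t (s i).
  have -> : t' = [tuple tnth t (s i) | i < a] by apply: val_inj.
  by rewrite tnth_mktuple.
apply: (conjP _ _ (tnth t' i)); try exact: lin_component.
  by rewrite eq_t'.
by [].
Qed.

End Towers.

(** * Passage to the symmetric group, induced characters and the theorem *)

Section Transport.

Variables (X Y : finType) (h : X -> Y) (k : Y -> X).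
Hypotheses (hK : cancel h k) (kK : cancel k h).

Lemma transport_subproof (g : {perm X}) : injective (fun v => h (g (k v))).
Proof. by move=> v w /(can_inj hK)/perm_inj/(can_inj kK). Qed.

Definition transport g : {perm Y} := perm (@transport_subproof g).

Lemma transportE g u : transport g (h u) = h (g u).
Proof. by rewrite permE hK. Qed.

Lemma transportM g g' : transport (g * g')%g = (transport g * transport g')%g.
Proof. by apply/permP=> v; rewrite -(kK v) permM !transportE permM. Qed.

Lemma transport_inj : injective transport.
Proof.
move=> g g' /permP eq_g; apply/permP=> u; apply: (can_inj hK).
by have := eq_g (h u); rewrite !transportE.
Qed.

End Transport.

(** A bijection of the points carries the model to a subgroup that is Sylow by its order, hence
    conjugate to [P]; relabelling and conjugation both preserve cycle types, so weights are
    unchanged. *)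
Lemma sylow_sym_model n p (P : {group 'S_n}) : prime p -> p.-Sylow([set: 'S_n]) P ->
  exists (X : finType) (Q : {group {perm X}}) (rho : {perm X} -> 'S_n),
  [/\ injective rho, {morph rho : g h / g * h}%g, rho @: Q = P,
      forall N g y, weight p N (rho g) y = weight p N g y
    & forall chi xi, lin_on Q chi -> lin_on Q xi ->
        (forall N y, cycle_index p N Q chi y = cycle_index p N Q xi y) ->
      norm_conj Q chi xi].
Proof.
move=> p_pr sylP; have lt_n : (n < p ^ n)%N by rewrite ltn_expl ?prime_gt1.
have [X [Q [cardX cardQ _ conjQ]]] := sylow_model p_pr lt_n.
pose h (u : X) : 'I_n := cast_ord cardX (enum_rank u).
pose k (i : 'I_n) : X := enum_val (cast_ord (esym cardX) i).
have hK : cancel h k by move=> u; rewrite /h /k cast_ordK enum_rankK.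
have kK : cancel k h by move=> i; rewrite /h /k enum_valK cast_ordKV.
pose sigma := transport hK kK.
have sigmaM : {in Q &, {morph sigma : g g' / g * g'}%g}.
  by move=> g g' _ _; apply: transportM.
pose f := Morphism sigmaM.
have sylQ : p.-Sylow([set: 'S_n]) (f @* Q).
  rewrite pHallE subsetT card_injm //; last by apply/injmP=> g g' _ _ /transport_inj.
  by rewrite cardQ cardsT card_Sn eqxx.
have [z _ defP] := Sylow_trans sylQ sylP.
exists X, Q, (fun g => sigma g ^ z)%g; split.
- by move=> g g' /conjg_inj/transport_inj.
- by move=> g g'; rewrite /sigma transportM conjMg.
- by rewrite defP /= morphimEdom /conjugate -imset_comp.
- move=> N g y; rewrite weightJ (@weight_bij p N _ _ h g) //; first by exists k.
  by move=> u; apply: transportE.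
by move=> chi xi lin_chi lin_xi eqC; apply: conjQ => // N y _; apply: eqC.
Qed.

(** A form of Frobenius reciprocity, without complex conjugation; applied to weights, it shows that
    the induced character determines the cycle index. *)
Lemma sum_cfInd (gT : finGroupType) (G H : {group gT}) (phi : 'CF(H)) (w : gT -> algC) :
    H \subset G -> {in G &, forall g t, w (g ^ t)%g = w g} ->
  \sum_(g in G) 'Ind[G] phi g * w g = #|G|%:R / #|H|%:R * \sum_(g in H) phi g * w g.
Proof.
move=> sHG wJ.
transitivity (#|H|%:R^-1 * \sum_(t in G) \sum_(g in G) phi (g ^ t)%g * w g).
  rewrite exchange_big mulr_sumr; apply: eq_bigr => g Gg.
  by rewrite cfIndE // -mulrA mulr_suml.
rewrite [_ / _]mulrC -mulrA; congr (_ * _).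
rewrite mulr_natl -sumr_const; apply: eq_bigr => t Gt.
(* Conjugation by [t] permutes [G] and fixes [w], so every [t] contributes the same sum. *)
transitivity (\sum_(g in G) phi g * w g).
  rewrite [RHS](reindex_inj (conjg_inj t)); apply: eq_big => g; rewrite ?groupJr //.
  by move=> Gg; rewrite wJ.
rewrite (big_setID H) /= (setIidPr sHG) [X in _ + X]big1 ?addr0 // => g.
by case/setDP=> _ H'g; rewrite cfun0 ?mul0r.
Qed.

Lemma cfInd_conjg (gT : finGroupType) (G H : {group gT}) (phi : 'CF(H)) t :
  H \subset G -> t \in 'N_G(H)%g -> 'Ind[G] (phi ^ t)%CF = 'Ind[G] phi.
Proof.
move=> sHG /setIP[Gt Nt]; apply/cfunP=> g; rewrite !cfIndE //; congr (_ * _).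
rewrite (reindex_inj (mulIg t)); apply: eq_big => u; first by rewrite groupMr.
by rewrite cfConjgE // conjgM conjgK.
Qed.

Theorem theorem1 (n p : nat) (P : {group 'S_n}) (phi psi : 'CF(P)) :
  prime p ->
  p.-Sylow([set: 'S_n]) P ->
  phi \is a linear_char ->
  psi \is a linear_char ->
  'Ind[[set: 'S_n]] phi = 'Ind[[set: 'S_n]] psi <->
  (exists2 y : 'S_n, y \in 'N_[set: 'S_n](P) & psi = (phi ^ y)%CF).
Proof.
move=> p_pr sylP lin_phi lin_psi.
split=> [eqInd | [t Nt ->]]; last by rewrite cfInd_conjg ?subsetT.
have [X [Q [rho [rho_inj rhoM defP wE conjQ]]]] := sylow_sym_model p_pr sylP.
have Prho g : g \in Q -> rho g \in P by move=> Qg; rewrite -defP imset_f.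
have rho1 : rho 1%g = 1%g by apply: (mulgI (rho 1%g)); rewrite -rhoM !mulg1.
have rhoJ g t : rho (g ^ t)%g = (rho g ^ rho t)%g.
  by apply: (mulgI (rho t)); rewrite -rhoM -!conjgC rhoM.
have lin_rho (chi : 'CF(P)) : chi \is a linear_char -> lin_on Q (chi \o rho).
  move=> lin_chi; split=> [|g h Qg Qh] /=; first by rewrite rho1 lin_char1.
  by rewrite rhoM lin_charM ?Prho.
have cycleE (chi : 'CF(P)) N y :
  cycle_index p N Q (chi \o rho) y = \sum_(g in P) chi g * weight p N g y.
  transitivity (\sum_(g in rho @: Q) chi g * weight p N g y); last first.
    by apply: eq_bigl => g; rewrite defP.
  rewrite big_imset /=; last by move=> g h _ _; apply: rho_inj.
  by apply: eq_bigr => g _; rewrite wE.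
have [N y|s Ns conj_s] := conjQ _ _ (lin_rho _ lin_phi) (lin_rho _ lin_psi).
  (* Both induced characters are paired with the weight; the common nonzero index factor then
     cancels. *)
  have := congr1 (fun th : 'CF([set: 'S_n]) =>
    \sum_(g in [set: 'S_n]) th g * weight p N g y) eqInd.
  rewrite !sum_cfInd ?subsetT // -?cycleE; try by move=> g t _ _; apply: weightJ.
  by apply/mulfI; rewrite mulf_neq0 ?invr_eq0 ?neq0CG.
have Nrho : rho s \in 'N(P)%g.
  rewrite inE; apply/subsetP=> _ /imsetP[g Pg ->]; move: Pg; rewrite -defP.
  by case/imsetP=> u Qu ->; rewrite -rhoJ imset_f ?memJ_norm.
(* The inverse appears because [(phi ^ y)%CF] evaluates [phi] at the conjugate by the inverse of
   [y]. *)
exists (rho s)^-1%g; first by rewrite inE in_setT groupV.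
apply/cfun_inP=> g Pg; rewrite cfConjgE ?groupV // invgK.
have /imsetP[u Qu ->]: g \in rho @: Q by rewrite defP.
by rewrite -rhoJ; apply: conj_s.
Qed.
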